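(* There is a universal constant $c>0$ such that the following holds. Let $m\ge2$ and let $G$ be the disjoint union of $m$ loop-less cliques, the $\bar k$-th clique having size $n_{\bar k}\ge 2$, $\bar k=1,\dots,m$. Then for all sufficiently large $T$ (how large may depend on $G$), the mini-max regret of $G$ satisfies $$R_G^*(T)\le c\,\Big(\sum_{\bar k=1}^m\log n_{\bar k}\Big)^{\frac13}\cdot T^{\frac23}.$$
   Context: **Problem (bandit with graph feedback).** $G=(V,E)$ is a finite directed graph, possibly with self-loops; vertices are called arms. $N_{\mathrm{out}}(v)=\{u:(v,u)\in E\}$. The player knows $G$ and the horizon $T$. In each round $t=1,\dots,T$ the player's (randomized) algorithm computes from past observations a distribution on $V$ and samples an arm $A_t$ from it; there is a loss vector $\ell^{(t)}:V\to[0,1]$; the player pays $\ell^{(t)}(A_t)$ and observes exactly the values $\ell^{(t)}(v)$ for $v\in N_{\mathrm{out}}(A_t)$. For an algorithm $\mathcal A$ and a fixed loss sequence $\mathcal L$, the regret with respect to arm $a$ is $R_a(G,T,\mathcal A,\mathcal L)=\mathbf E[\sum_{t=1}^T\ell^{(t)}(A_t)]-\sum_{t=1}^T\ell^{(t)}(a)$. The mini-max regret is $R_G^*(T)=\inf_{\mathcal A}\sup_{\mathcal L}R_{a^*}(G,T,\mathcal A,\mathcal L)$, where $a^*\in\arg\min_a\sum_t\ell^{(t)}(a)$ is the best fixed arm for $\mathcal L$. A loop-less clique on a vertex set $V_{\bar k}$ has edge set $\{(i,j):i,j\in V_{\bar k},\,i\ne j\}$; in the disjoint union there are no edges between different cliques.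 *)

(* Defs.v *)
From mathcomp Require Import all_boot all_order all_algebra.
From mathcomp Require Import all_classical all_reals all_analysis.

Set Implicit Arguments.
Unset Strict Implicit.
Unset Printing Implicit Defensive.

Import Order.TTheory GRing.Theory Num.Theory.
Local Open Scope classical_set_scope.
Local Open Scope ring_scope.

(* A finite directed graph is a finite type of arms [V] with an edge relation
   [E : rel V]; nothing is assumed about [E], so self-loops are allowed. *)

Record distribution (R : realType) (V : finType) := Distribution {
  dprob :> V -> R ;
  dprob_ge0 : forall v, 0 <= dprob v ;
  dprob_sum1 : \sum_(v : V) dprob v = 1 }.

(* The value of the loss at [v] is revealed exactly when [v] is an
   out-neighbour of the arm [a] played. *)
Definition feedback (R : realType) (V : finType) (E : rel V) (l : V -> R)
    (a : V) : {ffun V -> option R} :=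
  [ffun v => if E a v then Some (l v) else None].

(* The past rounds, oldest first: arm played and feedback received. *)
Definition history (R : realType) (V : finType) :=
  seq (V * {ffun V -> option R}).

Definition algorithm (R : realType) (V : finType) :=
  history R V -> distribution R V.

(* Rounds are numbered 0, ..., T-1. *)
Definition loss_sequence (R : realType) (V : finType) (T : nat)
    (L : 'I_T -> V -> R) : Prop :=
  forall t v, 0 <= L t v <= 1.

Definition history_before (R : realType) (V : finType) (E : rel V) (T : nat)
    (L : 'I_T -> V -> R) (A : {ffun 'I_T -> V}) (t : nat) : history R V :=
  [seq (A s, feedback E (L s) (A s)) | s : 'I_T <- enum 'I_T & (s < t)%N].

(* Probability that the arms played over the T rounds are exactly
   [A 0, ..., A (T-1)]: the law of (A_0, ..., A_{T-1}), by the chain rule. *)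
Definition play_law (R : realType) (V : finType) (E : rel V) (T : nat)
    (alg : algorithm R V) (L : 'I_T -> V -> R) (A : {ffun 'I_T -> V}) : R :=
  \prod_(t < T) alg (history_before E L A t) (A t).

Definition expected_loss (R : realType) (V : finType) (E : rel V) (T : nat)
    (alg : algorithm R V) (L : 'I_T -> V -> R) : R :=
  \sum_(A : {ffun 'I_T -> V}) play_law E alg L A * \sum_(t < T) L t (A t).

Definition regret (R : realType) (V : finType) (E : rel V) (T : nat)
    (alg : algorithm R V) (L : 'I_T -> V -> R) (a : V) : R :=
  expected_loss E alg L - \sum_(t < T) L t a.

Definition best_arm (R : realType) (V : finType) (T : nat)
    (L : 'I_T -> V -> R) (a : V) : Prop :=
  forall b, \sum_(t < T) L t a <= \sum_(t < T) L t b.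

(* The regret takes the same value at all best arms of [L], so ranging over
   all of them amounts to selecting one. *)
Definition worst_case_regret (R : realType) (V : finType) (E : rel V)
    (T : nat) (alg : algorithm R V) : \bar R :=
  ereal_sup [set x | exists (L : 'I_T -> V -> R) (a : V),
    [/\ loss_sequence L, best_arm L a & x = (regret E alg L a)%:E]].

(* The infimum is taken for fixed [E] and [T]: the player knows both. *)
Definition minimax_regret (R : realType) (V : finType) (E : rel V)
    (T : nat) : \bar R :=
  ereal_inf (range (fun alg : algorithm R V => worst_case_regret E T alg)).

Definition disjoint_loopless_cliques (V : finType) (E : rel V) (m : nat)
    (n : 'I_m -> nat) : Prop :=
  exists P : 'I_m -> {set V},
    [/\ forall v, exists! k, v \in P k,
        forall k, #|P k| = n k &
        forall u v, E u v <->
          u <> v /\ exists k, u \in P k /\ v \in P k].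

(* Main.v *)
(* The player runs a two-level potential forecaster on importance-weighted
   cumulative loss estimates L. Inside clique k it uses exponential weights at
   rate h ln n_k, whose potential g_k(L) is a soft minimum of L; across the
   cliques it uses the 1/2-Tsallis regularizer applied to the values g_k(L).
   The composed potential is at least -3/h at L = 0, never exceeds L(a), and
   grows by the loss of the player up to second-order terms. With probability
   gamma the player explores: clique k is drawn with weight half proportional
   to ln n_k and half proportional to the square root of its Tsallis weight,
   then an arm uniformly in the clique, so that every arm of clique k is
   observed with probability at least half the exploration of the clique (a
   uniform arm misses only itself). These proportions bound the expected
   second-order terms of each round by O(h S / gamma), S = \sum_k ln n_k, with
   no factor ln m. The regret is thus at most 3/h + T (gamma + 12 h S / gamma),
   and gamma = (S/T)^(1/3), h = S^(-1/3) T^(-2/3) give 16 S^(1/3) T^(2/3). *)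
Require Import Defs.
From mathcomp Require Import all_boot all_order all_algebra.
From mathcomp Require Import all_classical all_reals all_analysis.
From mathcomp Require Import ring lra.

Set Implicit Arguments.
Unset Strict Implicit.
Unset Printing Implicit Defensive.

Import Order.TTheory GRing.Theory Num.Theory.
Import numFieldNormedType.Exports.
Local Open Scope classical_set_scope.
Local Open Scope ring_scope.

(** * Regret from a potential *)

Section Plays.
Variables (R : realType) (V : finType) (E : rel V).

Definition ffun_cons n (a : V) (A : {ffun 'I_n -> V}) : {ffun 'I_n.+1 -> V} :=
  [ffun t => oapp A a (unlift ord0 t)].

Lemma ffun_cons0 n (a : V) (A : {ffun 'I_n -> V}) : ffun_cons a A ord0 = a.
Proof. by rewrite ffunE unlift_none. Qed.

Lemma ffun_consS n (a : V) (A : {ffun 'I_n -> V}) t :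
  ffun_cons a A (lift ord0 t) = A t.
Proof. by rewrite ffunE liftK. Qed.

Lemma sum_ffun_cons n (F : {ffun 'I_n.+1 -> V} -> R) :
  \sum_A F A = \sum_(a : V) \sum_(A : {ffun 'I_n -> V}) F (ffun_cons a A).
Proof.
rewrite pair_big /= (reindex (fun p => ffun_cons p.1 p.2)) //=.
exists (fun A => (A ord0, [ffun t => A (lift ord0 t)])) => [[a A] _|A _] /=.
  by rewrite ffun_cons0; congr pair; apply/ffunP => t; rewrite ffunE ffun_consS.
apply/ffunP => t; case: (unliftP ord0 t) => [s|] ->.
  by rewrite ffun_consS ffunE.
by rewrite ffun_cons0.
Qed.

Lemma history_before0 n (L : 'I_n -> V -> R) A : history_before E L A 0 = [::].
Proof.
rewrite /history_before (eq_filter (a2 := pred0)); last by [].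
by rewrite filter_pred0.
Qed.

Lemma history_before_cons n (L : 'I_n.+1 -> V -> R) a A t :
  history_before E L (ffun_cons a A) t.+1 =
  (a, feedback E (L ord0) a)
    :: history_before E (fun s => L (lift ord0 s)) A t.
Proof.
rewrite /history_before enum_ordSl /= ffun_cons0; congr cons.
rewrite filter_map -map_comp (eq_filter (a2 := fun s : 'I_n => (s < t)%N)) //.
by apply: eq_map => s /=; rewrite ffun_consS.
Qed.

(** Telescoping: in each round the conditional expectation of [F] rises by at least the regret of
    that round minus [D], and [F] never ends above zero. The induction peels off the first round,
    hence the arbitrary past [h0]; normalization is proved alongside because averaging first-round
    constants over later plays uses it. *)
Lemma regret_le_drift_from (alg : algorithm R V) (a0 : V) (F : history R V -> R)
    (D : R) (T : nat) (L : 'I_T -> V -> R) (h0 : history R V) :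
  (forall h, F h <= 0) ->
  (forall t h, F h + \sum_v alg h v * L t v - L t a0 - D <=
               \sum_v alg h v * F (rcons h (v, feedback E (L t) v))) ->
  let law A := \prod_(t < T) alg (h0 ++ history_before E L A t) (A t) in
  \sum_A law A = 1 /\
  \sum_A law A * (\sum_t L t (A t) - \sum_t L t a0 - D * T%:R) <= - F h0.
Proof.
move=> F0; elim: T L h0 => [|T IH] L h0 drift.
  have unique (A : {ffun 'I_0 -> V}) : A = [ffun x => a0].
    by apply/ffunP; case.
  have lawE (G : {ffun 'I_0 -> V} -> R) : \sum_A G A = G [ffun x => a0].
    rewrite (bigD1 [ffun x => a0]) //= big1 ?addr0 // => A.
    by rewrite (unique A) eqxx.
  split=> /=; rewrite lawE !big_ord0 //.
  by rewrite mul1r mulr0 !subr0 oppr_ge0.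
move=> law.
pose h1 v := rcons h0 (v, feedback E (L ord0) v).
pose L' s := L (lift ord0 s).
pose law' v A := \prod_(t < T) alg (h1 v ++ history_before E L' A t) (A t).
have lawE a A : law (ffun_cons a A) = alg h0 a * law' a A.
  rewrite /law big_ord_recl history_before0 cats0 ffun_cons0; congr (_ * _).
  apply: eq_bigr => t _; rewrite ffun_consS.
  by rewrite lift0 history_before_cons -cat_rcons.
have IHv v := IH L' (h1 v) (fun t => drift (lift ord0 t)).
have sum1 v : \sum_A law' v A = 1 by case: (IHv v).
split.
  rewrite sum_ffun_cons (eq_bigr (fun a => alg h0 a)) ?dprob_sum1 // => a _.
  under eq_bigr => A _ do rewrite lawE.
  by rewrite -mulr_sumr sum1 mulr1.
rewrite sum_ffun_cons.
have step a : \sum_A law (ffun_cons a A) *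
    (\sum_t L t (ffun_cons a A t) - \sum_t L t a0 - D * T.+1%:R) <=
    alg h0 a * (L ord0 a - L ord0 a0 - D) - alg h0 a * F (h1 a).
  case: (IHv a) => _ /(ler_wpM2l (dprob_ge0 (alg h0) a)).
  rewrite mulrN mulr_sumr -(lerD2l (alg h0 a * (L ord0 a - L ord0 a0 - D))).
  apply: le_trans.
  have -> : alg h0 a * (L ord0 a - L ord0 a0 - D) =
      \sum_A law' a A * (alg h0 a * (L ord0 a - L ord0 a0 - D)).
    by rewrite -mulr_suml sum1 mul1r.
  rewrite -big_split /=; apply: ler_sum => A _.
  rewrite lawE !big_ord_recl ffun_cons0.
  have -> : \sum_i L (lift ord0 i) (ffun_cons a A (lift ord0 i)) =
            \sum_i L' i (A i) by apply: eq_bigr => t _; rewrite ffun_consS.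
  by rewrite -(natr1 T) -/(law' a A) /L'; lra.
apply: (le_trans (ler_sum _ (fun a _ => step a))).
rewrite big_split /= sumrN.
have -> : \sum_v alg h0 v * (L ord0 v - L ord0 a0 - D) =
   \sum_v alg h0 v * L ord0 v - L ord0 a0 - D.
  under eq_bigr => v _ do rewrite !mulrBr.
  by rewrite !sumrB -!mulr_suml dprob_sum1 !mul1r.
have := drift ord0 h0; rewrite -/h1; lra.
Qed.

Lemma regret_le_drift (alg : algorithm R V) (a0 : V) (F : history R V -> R)
    (D : R) (T : nat) (L : 'I_T -> V -> R) :
  (forall h, F h <= 0) ->
  (forall t h, F h + \sum_v alg h v * L t v - L t a0 - D <=
               \sum_v alg h v * F (rcons h (v, feedback E (L t) v))) ->
  regret E alg L a0 <= D * T%:R - F [::].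
Proof.
move=> F0 drift; have [] := regret_le_drift_from [::] F0 drift.
rewrite /= => sum1.
under eq_bigr => A _ do rewrite -addrA -opprD mulrBr.
rewrite sumrB -mulr_suml sum1 mul1r /regret /expected_loss /play_law; lra.
Qed.

End Plays.

(** * Exponential weights *)

Section ExponentialWeights.
Variables (R : realType) (V : finType) (P : pred V) (a0 : V) (b : R).
Hypotheses (Pa0 : P a0) (b0 : 0 < b).

Definition partition_fun (L : V -> R) := \sum_(v | P v) expR (- (b * L v)).
Definition soft_min (L : V -> R) := - ln (partition_fun L) / b.
(** A probability vector on [P] only: it is not set to zero elsewhere, so sums against it carry the
    filter [P v]. *)
Definition soft_weight (L : V -> R) v := expR (- (b * L v)) / partition_fun L.

Definition soft_mean L (l : V -> R) := \sum_(v | P v) soft_weight L v * l v.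
Definition soft_meansq L (l : V -> R) :=
  \sum_(v | P v) soft_weight L v * l v ^+ 2.

Lemma partition_fun_ge L a : P a -> expR (- (b * L a)) <= partition_fun L.
Proof.
move=> Pa; rewrite /partition_fun (bigD1 a) //= lerDl.
by apply: sumr_ge0 => v _; exact: expR_ge0.
Qed.

Lemma partition_fun_gt0 L : 0 < partition_fun L.
Proof. exact: lt_le_trans (expR_gt0 _) (partition_fun_ge L Pa0). Qed.

Lemma soft_weight_ge0 L v : 0 <= soft_weight L v.
Proof. by rewrite divr_ge0 ?expR_ge0 ?ltW ?partition_fun_gt0. Qed.

Lemma soft_weight_sum1 L : \sum_(v | P v) soft_weight L v = 1.
Proof. by rewrite -mulr_suml divff // gt_eqF // partition_fun_gt0. Qed.

Lemma soft_min_le L a : P a -> soft_min L <= L a.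
Proof.
move=> Pa; rewrite /soft_min ler_pdivrMr // lerNl mulrC.
rewrite -[leLHS]expRK ler_ln ?posrE ?expR_gt0 ?partition_fun_gt0 //.
exact: partition_fun_ge.
Qed.

Lemma soft_min0 : soft_min (fun=> 0) = - ln #|P|%:R / b.
Proof.
rewrite /soft_min /partition_fun; under eq_bigr do rewrite mulr0 oppr0 expR0.
by rewrite sumr_const.
Qed.

Lemma partition_funD L l : partition_fun (L \+ l) =
  partition_fun L * \sum_(v | P v) soft_weight L v * expR (- (b * l v)).
Proof.
rewrite mulr_sumr; apply: eq_bigr => v _.
rewrite /soft_weight mulrA [X in X * expR (- (b * l v))]mulrC divfK.
  by rewrite -expRD; congr expR; rewrite mulrDr opprD.
by rewrite gt_eqF // partition_fun_gt0.
Qed.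

Let mix L l := \sum_(v | P v) soft_weight L v * expR (- (b * l v)).

Let mix_gt0 L l : 0 < mix L l.
Proof.
rewrite -(pmulr_rgt0 _ (partition_fun_gt0 L)) -partition_funD.
exact: partition_fun_gt0.
Qed.

Let soft_minD L l : soft_min (L \+ l) - soft_min L = - ln (mix L l) / b.
Proof.
rewrite /soft_min partition_funD -/(mix L l) lnM ?posrE ?partition_fun_gt0 //.
by rewrite -mulrBl; congr (_ / b); ring.
Qed.

Lemma soft_minD_ge0 L (l : V -> R) : (forall v, 0 <= l v) ->
  0 <= soft_min (L \+ l) - soft_min L.
Proof.
move=> l0; rewrite soft_minD divr_ge0 ?(ltW b0) // oppr_ge0 ln_le0 //.
apply: (@le_trans _ _ (\sum_(v | P v) soft_weight L v)); last first.
  by rewrite soft_weight_sum1.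
rewrite /mix; apply: ler_sum => v _.
rewrite ler_piMr ?soft_weight_ge0 // -expR0 ler_expR oppr_le0.
by rewrite mulr_ge0 ?(ltW b0).
Qed.

(* Jensen, through the tangent of the exponential at the mean. *)
Lemma soft_minD_le L l : soft_min (L \+ l) - soft_min L <= soft_mean L l.
Proof.
rewrite soft_minD ler_pdivrMr // lerNl mulrC -[leLHS]expRK.
rewrite ler_ln ?posrE ?expR_gt0 ?mix_gt0 //.
pose M := soft_mean L l.
have -> : expR (- (b * M)) =
    \sum_(v | P v) soft_weight L v * (expR (- (b * M)) * (1 + (b * M - b * l v))).
  transitivity (expR (- (b * M)) * ((1 + b * M) * \sum_(v | P v) soft_weight L v
     - b * M)); first by rewrite soft_weight_sum1; ring.
  rewrite mulr_sumr {4}/M /soft_mean mulr_sumr -sumrB mulr_sumr.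
  by apply: eq_bigr => v _; ring.
apply: ler_sum => v _; apply: ler_wpM2l; first exact: soft_weight_ge0.
have <- : expR (- (b * M)) * expR (b * M - b * l v) = expR (- (b * l v)).
  by rewrite -expRD; congr expR; ring.
by apply: ler_wpM2l; [exact: expR_ge0|exact: expR_ge1Dx].
Qed.

(** [expR (- x) <= (1 + x)^-1], and [(1 + x) * (1 - x + x ^+ 2) = 1 + x ^+ 3]. *)
Lemma expRN_le_quadratic (x : R) : 0 <= x -> expR (- x) <= 1 - x + x ^+ 2.
Proof.
move=> x0; rewrite expRN; have x1 : 0 < 1 + x by lra.
apply: (@le_trans _ _ (1 + x)^-1).
  by rewrite lef_pV2 ?posrE ?expR_gt0 // expR_ge1Dx.
rewrite -div1r ler_pdivrMr //; have := exprn_ge0 3 x0; nra.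
Qed.

(** Expand the exponential to second order inside the logarithm, then use [1 + y <= expR y]. No
    upper bound on [l] enters, so large importance-weighted losses are covered. *)
Lemma soft_minD_ge L (l : V -> R) : (forall v, 0 <= l v) ->
  soft_mean L l - b * soft_meansq L l <= soft_min (L \+ l) - soft_min L.
Proof.
move=> l0; rewrite soft_minD ler_pdivlMr // lerNr.
have mixE : mix L l <= 1 + (- (b * soft_mean L l) + b ^+ 2 * soft_meansq L l).
  rewrite -[X in X + _](soft_weight_sum1 L) /mix !mulr_sumr -sumrN -!big_split /=.
  apply: ler_sum => v _.
  apply: le_trans (ler_wpM2l (soft_weight_ge0 L v)
     (expRN_le_quadratic (mulr_ge0 (ltW b0) (l0 v)))) _.
  by lra.
have -> : - ((soft_mean L l - b * soft_meansq L l) * b) =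
  - (b * soft_mean L l) + b ^+ 2 * soft_meansq L l by ring.
set y := _ + _ in mixE *.
rewrite -[leRHS]expRK ler_ln ?posrE ?expR_gt0 ?mix_gt0 //.
exact: le_trans mixE (expR_ge1Dx _).
Qed.

Lemma soft_mean_sq_le L l : soft_mean L l ^+ 2 <= soft_meansq L l.
Proof.
rewrite -subr_ge0; have [M ME] : {M | soft_mean L l = M} by exists (soft_mean L l).
rewrite ME.
have -> : soft_meansq L l - M ^+ 2 = \sum_(v | P v) soft_weight L v * (l v - M) ^+ 2.
  transitivity (soft_meansq L l - 2 * M * soft_mean L l +
     M ^+ 2 * \sum_(v | P v) soft_weight L v).
    by rewrite soft_weight_sum1 ME; ring.
  rewrite !mulr_sumr -sumrB -big_split /=; apply: eq_bigr => v _; ring.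
by apply: sumr_ge0 => v _; rewrite mulr_ge0 ?soft_weight_ge0 ?sqr_ge0.
Qed.

End ExponentialWeights.

(** * The Tsallis potential *)

Section TsallisPotential.
Variables (R : realType) (K : finType) (k0 : K) (h : R).
Hypothesis h0 : 0 < h.

Let m : R := #|K|%:R.

Let m_ge1 : 1 <= m.
Proof. by rewrite ler1n; apply/card_gt0P; exists k0. Qed.

(** [x] is the Lagrange multiplier that normalizes the Tsallis weights
    [(g k - x)^-2 / (m * h ^+ 2)]. *)
Definition is_level (g : K -> R) (x : R) :=
  (forall k, x < g k) /\ \sum_k (g k - x)^-1 ^+ 2 = m * h ^+ 2.

Lemma is_level_exists g : exists x, is_level g x.
Proof.
pose kmin := [arg min_(k < k0) g k]%O.
have gmin k : g kmin <= g k.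
  by rewrite /kmin; case: arg_minP => // i _; exact.
have mh0 : 0 < (m * h)^-1 by rewrite invr_gt0 mulr_gt0 // (lt_le_trans ltr01).
pose f x := \sum_k (g k - x)^-1 ^+ 2.
(* At [lo] every gap is at least [h^-1], so the sum is at most [m * h ^+ 2]; at [hi] the term of
   [kmin] alone is [(m * h) ^+ 2], already large enough as [m >= 1]. *)
pose lo := g kmin - h^-1; pose hi := g kmin - (m * h)^-1.
have lohi : lo <= hi.
  rewrite lerD2l lerN2 lef_pV2 ?posrE ?mulr_gt0 // ?(lt_le_trans ltr01) //.
  by rewrite ler_peMl // ltW.
have gap x k : x <= hi -> 0 < g k - x.
  by move=> xhi; have := gmin k; move: mh0 xhi; rewrite /hi; lra.
have fcont : {within `[lo, hi], continuous f}.
  apply: continuous_in_subspaceT => x; rewrite inE /= in_itv /= => /andP[_ xhi].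
  rewrite /f /continuous_at; apply: cvg_big => [|k _].
    exact: add_continuous.
  apply: (@continuous_comp _ _ _ (fun x => (g k - x)^-1) (fun x => x ^+ 2)).
    apply: continuousV; first by rewrite gt_eqF // gap.
    by apply: continuousB; [exact: cst_continuous|by []].
  exact: exprn_continuous.
have flo : f lo <= m * h ^+ 2.
  rewrite /m -sum1_card natr_sum mulr_suml; apply: ler_sum => k _.
  have c0 := gap _ k lohi; rewrite mul1r.
  apply: lerXn2r; rewrite ?nnegrE ?invr_ge0 ?(ltW c0) ?(ltW h0) //.
  rewrite -[leRHS]invrK lef_pV2 ?posrE ?invr_gt0 ?gap //.
  by have := gmin k; rewrite /lo; lra.
have fhi : m * h ^+ 2 <= f hi.
  rewrite /f (bigD1 kmin) //= /hi subKr invrK.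
  apply: ler_wpDr; first by apply: sumr_ge0 => k _; exact: sqr_ge0.
  by rewrite exprMn ler_wpM2r ?sqr_ge0 // expr2 ler_peMl.
have [|x] := IVT lohi fcont (v := m * h ^+ 2).
  by rewrite ge_min le_max flo fhi orbT.
rewrite in_itv /= => /andP[_ xhi] fx; exists x; split => // k.
by rewrite -subr_gt0 gap.
Qed.

Definition level (g : K -> R) : R := xget 0 [set x | is_level g x].

Lemma levelP g : is_level g (level g).
Proof. exact: (xgetPex 0 (is_level_exists g)). Qed.

(** This is [h * sqrt m] times the square root of the Tsallis weight, hence its use in the
    exploration. *)
Definition inv_gap (g : K -> R) k := (g k - level g)^-1.
Definition tsallis_weight (g : K -> R) k := inv_gap g k ^+ 2 / (m * h ^+ 2).
Definition tsallis_dual (g : K -> R) x := x - (\sum_k (g k - x)^-1) / (m * h ^+ 2).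
(* The minimum over distributions Z of
   [\sum_k Z k * g k - 2 / (h * sqrt m) * \sum_k sqrt (Z k)], in dual form. *)
Definition tsallis_potential (g : K -> R) := tsallis_dual g (level g).

Let r0 : 0 < m * h ^+ 2.
Proof. by rewrite mulr_gt0 ?exprn_gt0 // (lt_le_trans ltr01). Qed.

Lemma inv_gap_gt0 g k : 0 < inv_gap g k.
Proof. by rewrite invr_gt0 subr_gt0; case: (levelP g). Qed.

Lemma tsallis_weight_ge0 g k : 0 <= tsallis_weight g k.
Proof. by rewrite divr_ge0 ?sqr_ge0 ?ltW. Qed.

Lemma tsallis_weight_sum1 g : \sum_k tsallis_weight g k = 1.
Proof.
by rewrite -mulr_suml; case: (levelP g) => _ ->; rewrite divff // gt_eqF.
Qed.

(** Cauchy-Schwarz, through [2 * h * w <= w ^+ 2 + h ^+ 2] for each inverse gap [w]. *)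
Lemma sum_inv_gap_le g : \sum_k inv_gap g k <= m * h.
Proof.
have gapE : \sum_k inv_gap g k ^+ 2 = m * h ^+ 2 by case: (levelP g).
have : \sum_k (2 * h * inv_gap g k) <= \sum_k (inv_gap g k ^+ 2 + h ^+ 2).
  by apply: ler_sum => k _; have := sqr_ge0 (inv_gap g k - h); nra.
rewrite big_split /= gapE -mulr_sumr sumr_const -[in leRHS]mulr_natl -/m => le.
rewrite -(ler_pM2l (mulr_gt0 (ltr0n _ 2) h0)); nra.
Qed.

(* The dual function is concave with derivative [1 - \sum (g k - x)^-2 / (m h^2)],
   so the level is its maximizer. *)
Lemma tsallis_dual_le (g : K -> R) x : (forall k, x < g k) ->
  tsallis_dual g x <= tsallis_potential g.
Proof.
move=> xg; rewrite /tsallis_potential /tsallis_dual.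
set y := level g; have [yg yE] := levelP g; rewrite -/y in yg yE.
have term k : (x - y) * (g k - y)^-1 ^+ 2 <= (g k - x)^-1 - (g k - y)^-1.
  have cx : 0 < g k - x by rewrite subr_gt0.
  have cy : 0 < g k - y by rewrite subr_gt0.
  have -> : (g k - x)^-1 - (g k - y)^-1 = (x - y) * (g k - y)^-1 ^+ 2 +
      (x - y) ^+ 2 * ((g k - y)^-1 ^+ 2 * (g k - x)^-1).
    by field; rewrite !gt_eqF.
  by rewrite lerDl mulr_ge0 ?sqr_ge0 // mulr_ge0 ?sqr_ge0 // invr_ge0 ltW.
have : \sum_k (x - y) * (g k - y)^-1 ^+ 2 <=
       \sum_k ((g k - x)^-1 - (g k - y)^-1) by apply: ler_sum.
rewrite -mulr_sumr yE sumrB -ler_pdivlMr // mulrBl; lra.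
Qed.

Lemma tsallis_potential_le (g : K -> R) k : tsallis_potential g <= g k.
Proof.
apply: (@le_trans _ _ (level g)); last by rewrite ltW //; case: (levelP g).
rewrite gerBl divr_ge0 ?(ltW r0) //; apply: sumr_ge0 => i _.
exact: ltW (inv_gap_gt0 g i).
Qed.

Lemma tsallis_potential_cst_ge c : c - 2 * h^-1 <= tsallis_potential (fun=> c).
Proof.
(* Any point below [c] gives a lower bound by duality; [c - h^-1] is the level of the constant
   vector. *)
have lt : forall k : K, c - h^-1 < c.
  by move=> _; rewrite ltrBlDr ltrDl invr_gt0.
apply: le_trans (tsallis_dual_le lt); rewrite /tsallis_dual.
under eq_bigr do rewrite subKr invrK.
rewrite sumr_const -[h *+ _]mulr_natl -/m.
have -> : m * h / (m * h ^+ 2) = h^-1.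
  by field; rewrite !gt_eqF // (lt_le_trans ltr01).
by clear lt; lra.
Qed.

(** The old level still lies below [g \+ d], so the new dual evaluated there bounds the new
    potential from below. Termwise, [c^-1 - (c + d)^-1] exceeds [d / c ^+ 2 - d ^+ 2 / c ^+ 3] by a
    nonnegative cubic remainder. *)
Lemma tsallis_potentialD_ge (g d : K -> R) : (forall k, 0 <= d k) ->
  \sum_k (tsallis_weight g k * d k - inv_gap g k * tsallis_weight g k * d k ^+ 2)
  <= tsallis_potential (g \+ d) - tsallis_potential g.
Proof.
move=> d0; have [yg _] := levelP g.
have lt k : level g < (g \+ d) k by rewrite /= (lt_le_trans (yg k)) // lerDl.
rewrite lerBrDr; apply: le_trans (tsallis_dual_le lt).
rewrite /tsallis_potential /tsallis_dual -lerBrDr.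
have -> (u v y : R) : u - v / (m * h ^+ 2) - (u - y / (m * h ^+ 2)) =
    (y - v) / (m * h ^+ 2) by ring.
rewrite -sumrB mulr_suml.
apply: ler_sum => k _; rewrite /tsallis_weight /inv_gap /=.
set c := g k - level g.
have c0 : 0 < c by rewrite subr_gt0.
have -> : g k + d k - level g = c + d k by rewrite /c; ring.
have cd0 : 0 < c + d k by rewrite ltr_wpDr.
rewrite -subr_ge0.
have -> : (c^-1 - (c + d k)^-1) / (m * h ^+ 2) - (c^-1 ^+ 2 / (m * h ^+ 2) * d k -
    c^-1 * (c^-1 ^+ 2 / (m * h ^+ 2)) * d k ^+ 2) =
  d k ^+ 3 * (c^-1 ^+ 3 * (c + d k)^-1) / (m * h ^+ 2).
  by field; rewrite !gt_eqF // (lt_le_trans ltr01).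
by rewrite divr_ge0 ?(ltW r0) // mulr_ge0 ?exprn_ge0 //
  mulr_ge0 ?exprn_ge0 ?invr_ge0 ?ltW.
Qed.

End TsallisPotential.

(** * The two-level algorithm *)

Section TwoLevelAlgorithm.
Variables (R : realType) (V K : finType) (E : rel V) (kappa : V -> K) (k0 : K).
Variables (h gamma : R).

Definition clique k : pred V := [pred v | kappa v == k].

Hypotheses (h0 : 0 < h) (gamma0 : 0 < gamma) (gamma1 : gamma <= 1).
Hypothesis clique_ge2 : forall k, (2 <= #|clique k|)%N.
Hypothesis edgeE : forall u v, E u v = (u != v) && (kappa u == kappa v).

Let size k : R := #|clique k|%:R.
Definition log_size k : R := ln #|clique k|%:R.
Definition total_log := \sum_k log_size k.
Definition rate k := h * log_size k.
Definition inner (L : V -> R) k := soft_min (clique k) (rate k) L.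
Definition potential L := tsallis_potential h (inner L).
Definition outer_weight L := tsallis_weight h (inner L).
Definition inner_weight L v :=
  soft_weight (clique (kappa v)) (rate (kappa v)) L v.
Definition exploit L v := outer_weight L (kappa v) * inner_weight L v.
(* The first half of the exploration serves the learning inside the cliques;
   the second half, proportional to the square root of the outer weights,
   avoids a factor [ln m] in the learning across the cliques. *)
Definition explore L k :=
  (log_size k / total_log +
   inv_gap h (inner L) k / \sum_(i : K) inv_gap h (inner L) i) / 2.
Definition arm_prob L v :=
  (1 - gamma) * exploit L v +
  gamma * (explore L (kappa v) / #|clique (kappa v)|%:R).
Definition obs_prob L v := \sum_(u | E u v) arm_prob L u.

Let size_ge2 k : 2 <= size k. Proof. by rewrite ler_nat. Qed.

Let size_gt0 k : 0 < size k. Proof. exact: lt_le_trans (ltr0n _ 2) _. Qed.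

(** [expR (- (1 / 2)) >= 1 - 1 / 2] yields [ln 2 >= 1 / 2]. This lets [total_log] absorb the number
    of cliques. *)
Lemma log_size_ge_half k : 1 / 2 <= log_size k.
Proof.
apply: (@le_trans _ _ (ln 2)).
  rewrite -[leLHS]expRK ler_ln ?posrE ?expR_gt0 //.
  rewrite -[leLHS]invrK -[leRHS]invrK lef_pV2 ?posrE ?invr_gt0 ?expR_gt0 //.
  by rewrite -expRN; apply: le_trans (expR_ge1Dx _); lra.
by rewrite ler_ln ?posrE ?size_ge2 ?size_gt0.
Qed.

Let log_size_gt0 k : 0 < log_size k.
Proof. by apply: lt_le_trans (log_size_ge_half k); lra. Qed.

Lemma card_le_total_log : #|K|%:R <= 2 * total_log.
Proof.
rewrite -sum1_card natr_sum mulr_sumr; apply: ler_sum => k _.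
by have := log_size_ge_half k; lra.
Qed.

Lemma total_log_gt0 : 0 < total_log.
Proof.
rewrite /total_log (bigD1 k0) //= ltr_pwDl // sumr_ge0 // => k _; exact: ltW.
Qed.

Let rate_gt0 k : 0 < rate k. Proof. exact: mulr_gt0. Qed.

Let clique_inhab k : {v | clique k v}.
Proof.
by apply/sigW; have /card_gt0P := ltnW (clique_ge2 k); case=> v; exists v.
Qed.

Let gap_gt0 L k : 0 < inv_gap h (inner L) k.
Proof. exact: inv_gap_gt0. Qed.

Let sum_gap_gt0 L : 0 < \sum_(i : K) inv_gap h (inner L) i.
Proof.
by rewrite (bigD1 k0) //= ltr_pwDl // sumr_ge0 // => k _; exact: ltW.
Qed.

Lemma sum_clique (f : V -> R) : \sum_v f v = \sum_k \sum_(v | clique k v) f v.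
Proof. exact: partition_big. Qed.

Lemma inner_weight_ge0 L v : 0 <= inner_weight L v.
Proof.
by case: (clique_inhab (kappa v)) => a ak; apply: (soft_weight_ge0 _ ak).
Qed.

Lemma inner_weight_sum1 L k : \sum_(v | clique k v) inner_weight L v = 1.
Proof.
have [a ak] := clique_inhab k.
rewrite -[RHS](soft_weight_sum1 (rate k) ak L).
by apply: eq_bigr => v /eqP vk; rewrite /inner_weight vk.
Qed.

Lemma outer_weight_ge0 L k : 0 <= outer_weight L k.
Proof. exact: tsallis_weight_ge0. Qed.

Lemma explore_ge0 L k : 0 <= explore L k.
Proof.
by rewrite !(divr_ge0, addr_ge0) ?(ltW (log_size_gt0 _)) ?(ltW total_log_gt0)
  ?(ltW (gap_gt0 _ _)) ?(ltW (sum_gap_gt0 _)).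
Qed.

Lemma exploit_ge0 L v : 0 <= exploit L v.
Proof. by rewrite mulr_ge0 ?outer_weight_ge0 ?inner_weight_ge0. Qed.

Lemma arm_prob_ge0 L v : 0 <= arm_prob L v.
Proof.
rewrite addr_ge0 // mulr_ge0 ?exploit_ge0 ?subr_ge0 ?(ltW gamma0) //.
by rewrite divr_ge0 ?explore_ge0.
Qed.

Lemma sum_outer_inner L (f : K -> R) :
  \sum_v f (kappa v) * inner_weight L v = \sum_k f k.
Proof.
rewrite sum_clique; apply: eq_bigr => k _.
rewrite -[RHS]mulr1 -(inner_weight_sum1 L k) mulr_sumr.
by apply: eq_bigr => v /eqP ->.
Qed.

Lemma exploit_sum1 L : \sum_v exploit L v = 1.
Proof. by rewrite sum_outer_inner; exact: tsallis_weight_sum1. Qed.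

Lemma explore_sum1 L : \sum_k explore L k = 1.
Proof.
rewrite /explore -mulr_suml big_split /= -!mulr_suml -/total_log.
by field; rewrite !gt_eqF // total_log_gt0.
Qed.

Lemma arm_prob_sum1 L : \sum_v arm_prob L v = 1.
Proof.
rewrite big_split /= -!mulr_sumr exploit_sum1 sum_clique.
rewrite (eq_bigr (explore L)) => [|k _]; first by rewrite explore_sum1; ring.
transitivity (\sum_(v | clique k v) (explore L k / size k)).
  by apply: eq_bigr => v /eqP ->.
by rewrite sumr_const -[_ *+ _]mulr_natr -/(size k) divfK // gt_eqF.
Qed.

(** Keep only the exploration of the clique of [v]: all its arms but [v] itself observe [v], a
    fraction [1 - (size k)^-1 >= 1 / 2]. *)
Lemma obs_prob_ge L v : gamma * explore L (kappa v) / 2 <= obs_prob L v.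
Proof.
set k := kappa v; set c := gamma * explore L k.
have c0 : 0 <= c by rewrite mulr_ge0 ?explore_ge0 ?ltW.
apply: (@le_trans _ _ (\sum_(u | E u v) c / size k)); last first.
  apply: ler_sum => u; rewrite edgeE => /andP[_ /eqP uv].
  rewrite /arm_prob uv -/k -/(size k) -mulrA lerDr.
  by rewrite mulr_ge0 ?exploit_ge0 ?subr_ge0.
rewrite sumr_const -[leRHS]mulr_natr.
have -> : #|[pred u | E u v]| = #|clique k|.-1.
  rewrite (cardD1 v (clique k)) inE eqxx add1n /=; apply: eq_card => u.
  by rewrite !inE edgeE.
rewrite -subn1 natrB ?(ltnW (clique_ge2 k)) // -/(size k).
have -> : c / size k * (size k - 1) = c * (1 - (size k)^-1).
  by field; rewrite (gt_eqF (size_gt0 k)).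
apply: ler_wpM2l => //.
have : (size k)^-1 <= 2^-1 by rewrite lef_pV2 ?posrE.
lra.
Qed.

Lemma obs_prob_gt0 L v : 0 < obs_prob L v.
Proof.
apply: lt_le_trans (obs_prob_ge L v); rewrite divr_gt0 // mulr_gt0 //.
by rewrite divr_gt0 // addr_gt0 // divr_gt0 // total_log_gt0.
Qed.

Lemma potential_le L a : potential L <= L a.
Proof.
apply: le_trans (tsallis_potential_le k0 h0 (inner L) (kappa a)) _.
have aa : clique (kappa a) a by exact: eqxx.
exact: (soft_min_le aa (rate_gt0 _) L aa).
Qed.

Lemma potential0_ge : - (3 * h^-1) <= potential (fun=> 0).
Proof.
(* The rate [h * log_size k] cancels the logarithm, so all cliques start at the same value; the
   outer level then costs [2 * h^-1]. *)
rewrite /potential (_ : inner (fun=> 0) = fun=> - h^-1).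
  by apply: le_trans (tsallis_potential_cst_ge k0 h0 _); lra.
apply/funext => k; rewrite /inner soft_min0 /rate -/(log_size k).
by field; rewrite !gt_eqF.
Qed.

(** The rate comes from the exponential weights inside the clique, the inverse gap from the Tsallis
    level across cliques. *)
Definition second_order L v :=
  (rate (kappa v) + inv_gap h (inner L) (kappa v)) * exploit L v.

(** Feed the increments [d] of the inner potentials to the outer bound. Its linear term uses the
    lower bound on [d]; its quadratic term uses Jensen's upper bound, then square of mean at most
    mean of squares. *)
Lemma potentialD_ge L (l : V -> R) : (forall v, 0 <= l v) ->
  potential L + \sum_v exploit L v * l v - \sum_v second_order L v * l v ^+ 2
  <= potential (L \+ l).
Proof.
move=> l0; pose d k := inner (L \+ l) k - inner L k.
have d0 k : 0 <= d k.
  by have [a ak] := clique_inhab k; exact: (soft_minD_ge0 ak).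
have innerE : inner (L \+ l) = inner L \+ d.
  by apply/funext => k; rewrite /d /= addrC subrK.
have := tsallis_potentialD_ge k0 h0 (inner L) d0.
rewrite -innerE -/(potential L) -/(potential (L \+ l)).
suff : \sum_v exploit L v * l v - \sum_v second_order L v * l v ^+ 2 <=
  \sum_k (tsallis_weight h (inner L) k * d k -
          inv_gap h (inner L) k * tsallis_weight h (inner L) k * d k ^+ 2).
  lra.
rewrite -sumrB sum_clique; apply: ler_sum => k _.
have [a ak] := clique_inhab k.
pose x v := soft_weight (clique k) (rate k) L v.
pose mean := soft_mean (clique k) (rate k) L l.
pose meansq := soft_meansq (clique k) (rate k) L l.
set Z := tsallis_weight h _ k; set w := inv_gap h _ k.
have Z0 : 0 <= Z := outer_weight_ge0 L k.
have w0 : 0 < w := gap_gt0 L k.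
have dle : d k <= mean by exact: (soft_minD_le ak).
have dge : mean - rate k * meansq <= d k by exact: (soft_minD_ge ak).
have sq : d k ^+ 2 <= meansq.
  apply: le_trans (soft_mean_sq_le (rate k) ak L l).
  by rewrite lerXn2r ?nnegrE // (le_trans (d0 k)).
have -> : \sum_(v | clique k v)
    (exploit L v * l v - second_order L v * l v ^+ 2) =
    Z * (mean - rate k * meansq) - w * Z * meansq.
  rewrite /mean /meansq /soft_mean /soft_meansq mulrBr !mulr_sumr -!sumrB.
  apply: eq_bigr => v /eqP vk.
  rewrite /second_order /exploit /inner_weight vk -/(x v).
  rewrite -[outer_weight L k]/Z -/w; ring.
apply: lerB; first exact: ler_wpM2l.
by apply: ler_wpM2l => //; rewrite mulr_ge0 // ltW.
Qed.

Definition estimate L (fb : {ffun V -> option R}) v : R :=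
  if fb v is Some y then y / obs_prob L v else 0.

Lemma estimate_feedback L l a v :
  estimate L (feedback E l a) v = if E a v then l v / obs_prob L v else 0.
Proof. by rewrite /estimate ffunE; case: ifP. Qed.

(** The case [n = 1] is unbiasedness, [n = 2] the second moment. Positivity of [n] makes unobserved
    arms contribute zero, as [0 ^+ 0] is one. *)
Lemma sum_estimate L l (c : V -> R) n : (0 < n)%N ->
  \sum_a arm_prob L a * (\sum_v c v * estimate L (feedback E l a) v ^+ n) =
  \sum_v c v * (l v ^+ n / obs_prob L v ^+ n.-1).
Proof.
move=> n0; under eq_bigr do rewrite mulr_sumr.
rewrite exchange_big /=; apply: eq_bigr => v _.
transitivity (c v * (l v / obs_prob L v) ^+ n * obs_prob L v).
  rewrite [in RHS]/obs_prob mulr_sumr [RHS]big_mkcond /=; apply: eq_bigr => a _.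
  rewrite estimate_feedback; case: ifP => _.
    by rewrite -/(obs_prob L v); ring.
  by rewrite expr0n gtn_eqF //= !mulr0.
have := obs_prob_gt0 L v; case: n n0 => // n _ obs0 /=.
rewrite exprMn exprVn (exprS (obs_prob L v)); field.
by rewrite expf_neq0 ?gt_eqF.
Qed.

Definition drift_bound := gamma + 4 * h * (total_log + #|K|%:R) / gamma.

(** Each half of the exploration pays for one summand: the share [log_size k / total_log] for the
    rate, the share [w / W] for the inverse gap, with [W <= #|K|%:R * h]. *)
Lemma second_order_obs_le L v : second_order L v / obs_prob L v <=
  4 * h * (total_log + #|K|%:R) / gamma * exploit L v.
Proof.
rewrite /second_order [leLHS]mulrAC; apply: ler_wpM2r.
  exact: exploit_ge0.
rewrite ler_pdivrMr ?obs_prob_gt0 //.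
set k := kappa v; set w := inv_gap h _ k.
set W := \sum_(i : K) inv_gap h (inner L) i.
have W0 : 0 < W := sum_gap_gt0 L.
have S0 := total_log_gt0.
have expl1 : log_size k <= explore L k * (2 * total_log).
  have -> : explore L k * (2 * total_log) =
            log_size k + total_log * (w / W).
    by rewrite /explore -/w -/W; field; rewrite !gt_eqF.
  by rewrite lerDl mulr_ge0 ?(ltW S0) // divr_ge0 ?ltW // gap_gt0.
have expl2 : w <= explore L k * (2 * (#|K|%:R * h)).
  apply: (@le_trans _ _ (explore L k * (2 * W))).
    have -> : explore L k * (2 * W) = w + log_size k / total_log * W.
      by rewrite /explore -/w -/W; field; rewrite !gt_eqF.
    by rewrite lerDl mulr_ge0 ?(ltW W0) // divr_ge0 ?ltW.
  by rewrite ler_wpM2l ?explore_ge0 // ler_wpM2l // sum_inv_gap_le.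
have C0 : 0 <= 4 * h * (total_log + #|K|%:R) / gamma.
  by rewrite divr_ge0 ?(ltW gamma0) // !mulr_ge0 ?(ltW h0) // addr_ge0 // ltW.
apply: le_trans (ler_wpM2l C0 (obs_prob_ge L v)).
have -> : 4 * h * (total_log + #|K|%:R) / gamma * (gamma * explore L k / 2) =
    h * (explore L k * (2 * total_log)) + explore L k * (2 * (#|K|%:R * h)).
  by field; rewrite gt_eqF.
by rewrite lerD // /rate ler_wpM2l // ltW.
Qed.

Lemma potential_drift L l : (forall v, 0 <= l v <= 1) ->
  potential L + \sum_v arm_prob L v * l v - drift_bound <=
  \sum_a arm_prob L a * potential (L \+ estimate L (feedback E l a)).
Proof.
move=> l01.
pose e a := estimate L (feedback E l a).
have e0 a v : 0 <= e a v.
  rewrite /e estimate_feedback; case: ifP => // _.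
  by rewrite divr_ge0 ?(ltW (obs_prob_gt0 _ _)) //; case/andP: (l01 v).
have step a : arm_prob L a * (potential L + \sum_v exploit L v * e a v ^+ 1 -
     \sum_v second_order L v * e a v ^+ 2) <=
   arm_prob L a * potential (L \+ e a).
  by apply: ler_wpM2l; [exact: arm_prob_ge0|exact: (potentialD_ge L (e0 a))].
apply: le_trans (ler_sum _ (fun a _ => step a)).
have -> : \sum_a arm_prob L a * (potential L + \sum_v exploit L v * e a v ^+ 1 -
     \sum_v second_order L v * e a v ^+ 2) =
  potential L + \sum_v exploit L v * l v -
  \sum_v second_order L v * (l v ^+ 2 / obs_prob L v).
  under eq_bigr do rewrite mulrBr mulrDr.
  rewrite sumrB big_split /= -mulr_suml arm_prob_sum1 mul1r !sum_estimate //.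
  by congr (_ + _ - _); apply: eq_bigr => v _; rewrite divr1.
(* The exploring part has total mass [gamma] and is charged the maximal loss one. *)
have le1 : \sum_v arm_prob L v * l v <= \sum_v exploit L v * l v + gamma.
  have -> : gamma = \sum_v (arm_prob L v - (1 - gamma) * exploit L v).
    by rewrite sumrB -mulr_sumr arm_prob_sum1 exploit_sum1; ring.
  rewrite -big_split /=; apply: ler_sum => v _.
  have /andP[l0 l1] := l01 v.
  have x0 : 0 <= gamma * exploit L v * l v.
    by rewrite mulr_ge0 // mulr_ge0 ?exploit_ge0 // ltW.
  set y := gamma * (explore L (kappa v) / #|clique (kappa v)|%:R).
  have y0 : 0 <= y * (1 - l v).
    by rewrite mulr_ge0 ?subr_ge0 // mulr_ge0 ?(ltW gamma0) //
      divr_ge0 ?explore_ge0.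
  by rewrite /arm_prob -/y; move: x0 y0; lra.
have le2 : \sum_v second_order L v * (l v ^+ 2 / obs_prob L v) <=
    4 * h * (total_log + #|K|%:R) / gamma.
  rewrite -[leRHS]mulr1 -[X in _ <= _ * X](exploit_sum1 L) mulr_sumr.
  apply: ler_sum => v _.
  apply: le_trans (second_order_obs_le L v).
  have /andP[l0 l1] := l01 v.
  apply: ler_wpM2l.
    by rewrite mulr_ge0 ?exploit_ge0 // addr_ge0 // ltW // gap_gt0.
  rewrite ler_piMl ?invr_ge0 ?(ltW (obs_prob_gt0 _ _)) //.
  by rewrite expr_le1.
by rewrite /drift_bound; lra.
Qed.

(** A left fold, since each estimate divides by the observation probabilities of the state before
    its round. *)
Definition cumulative_estimate (hist : history R V) : V -> R :=
  foldl (fun L r => L \+ estimate L r.2) (fun=> 0) hist.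

Definition two_level_alg : algorithm R V := fun hist =>
  Distribution (arm_prob_ge0 (cumulative_estimate hist))
               (arm_prob_sum1 (cumulative_estimate hist)).

Lemma two_level_regret T (L : 'I_T -> V -> R) a : loss_sequence L ->
  regret E two_level_alg L a <= drift_bound * T%:R + 3 * h^-1.
Proof.
move=> L01.
(* Nonpositive since the potential is below every coordinate; by unbiasedness the subtracted
   estimate grows by [L t a] in expectation. *)
pose F hist := potential (cumulative_estimate hist) - cumulative_estimate hist a.
apply: le_trans (_ : drift_bound * T%:R - F [::] <= _); last first.
  by have := potential0_ge; rewrite /F /cumulative_estimate /=; lra.
apply: regret_le_drift => [hist|t hist]; first by rewrite subr_le0 potential_le.
set C := cumulative_estimate hist.
have stateE v : cumulative_estimate (rcons hist (v, feedback E (L t) v)) =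
    C \+ estimate C (feedback E (L t) v).
  by rewrite /cumulative_estimate foldl_rcons.
under [leRHS]eq_bigr do rewrite /F stateE /= opprD addrA mulrBr mulrBr.
rewrite !sumrB -mulr_suml arm_prob_sum1 mul1r.
have := potential_drift C (L01 t).
have pick_a (f : V -> R) : \sum_v (v == a)%:R * f v = f a.
  rewrite (bigD1 a) //= eqxx mul1r big1 ?addr0 // => v /negPf va.
  by rewrite va mul0r.
have -> : \sum_v arm_prob C v * estimate C (feedback E (L t) v) a = L t a.
  have := @sum_estimate C (L t) (fun v => (v == a)%:R) 1 isT.
  rewrite pick_a divr1 => sumE; rewrite -[RHS]/(L t a ^+ 1) -sumE.
  apply: eq_bigr => u _; congr (_ * _).
  by rewrite pick_a.
by rewrite /F -/C /two_level_alg /=; lra.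
Qed.

End TwoLevelAlgorithm.

(** * Clique labels and tuning of the parameters *)

Lemma disjoint_loopless_cliques_index (V : finType) (E : rel V) m
    (n : 'I_m -> nat) : disjoint_loopless_cliques E n ->
  exists kappa : V -> 'I_m, (forall k, #|clique kappa k| = n k) /\
    (forall u v, E u v = (u != v) && (kappa u == kappa v)).
Proof.
case=> P [Puniq Pcard PE].
have Pex v : exists k, v \in P k by case: (Puniq v) => k [vk _]; exists k.
have [kappa kappaP] := choice Pex.
have kappaE v k : (v \in P k) = (kappa v == k).
  apply/idP/eqP => [vk|<-]; last exact: kappaP.
  by case: (Puniq v) => i [_ iP]; rewrite -(iP _ vk) -(iP _ (kappaP v)).
exists kappa; split=> [k|u v].
  by rewrite -Pcard; apply: eq_card => v; rewrite inE kappaE.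
apply/idP/andP => [/PE[/eqP uv [k [uk vk]]]|[/eqP uv /eqP kuv]].
  by split=> //; move: uk vk; rewrite !kappaE => /eqP-> /eqP->.
by apply/PE; split=> //; exists (kappa u); rewrite !kappaE kuv eqxx.
Qed.

Theorem theorem3 (R : realType) :
  exists2 c : R, 0 < c &
    forall (m : nat) (n : 'I_m -> nat) (V : finType) (E : rel V),
      (2 <= m)%N -> (forall k, 2 <= n k)%N ->
      disjoint_loopless_cliques E n ->
      exists T0 : nat, forall T : nat, (T0 <= T)%N ->
        (minimax_regret R E T <=
          (c * (\sum_(k < m) ln (n k)%:R) `^ (1 / 3)
             * T%:R `^ (2 / 3))%:E)%E.
Proof.
exists 16 => // m n V E m2 n2 /disjoint_loopless_cliques_index[kappa [cardE edgeE]].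
have k0 : 'I_m := Ordinal (ltnW m2).
have clique2 k : (2 <= #|clique kappa k|)%N by rewrite cardE.
set S : R := \sum_(k < m) ln (n k)%:R.
have SE : total_log R kappa = S.
  by apply: eq_bigr => k _; rewrite /log_size cardE.
have S0 : 0 < S by rewrite -SE; exact: total_log_gt0.
have mS : #|'I_m|%:R <= 2 * S by rewrite -SE; exact: card_le_total_log.
(* This threshold forces [S <= T%:R], which gives [gamma <= 1]. *)
exists (Num.truncn S).+1 => T T0.
have ST : S <= T%:R.
  by apply: (le_trans (ltW (truncnS_gt S))); rewrite ler_nat.
have Tgt0 : 0 < T%:R :> R := lt_le_trans S0 ST.
(* Working with cube roots turns the final estimate into an identity of rational functions. *)
pose x := S `^ (1 / 3); pose y := T%:R `^ (1 / 3) : R.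
have cube (z : R) : 0 < z -> z = (z `^ (1 / 3)) ^+ 3.
  move=> z0; rewrite -powR_mulrn ?powR_ge0 // -powRrM.
  by rewrite (_ : 1 / 3 * 3%:R = 1) ?powRr1 ?ltW //; field.
have Sx : S = x ^+ 3 := cube _ S0.
have Ty : T%:R = y ^+ 3 := cube _ Tgt0.
have y2 : T%:R `^ (2 / 3) = y ^+ 2.
  by rewrite -powR_mulrn ?powR_ge0 // -powRrM; congr (_ `^ _); field.
have x0 : 0 < x by exact: powR_gt0.
have y0 : 0 < y by exact: powR_gt0.
have xy : x <= y.
  by rewrite -(@ler_pXn2r _ 3) ?nnegrE ?(ltW x0) ?(ltW y0) // -Sx -Ty.
pose h := (x * y ^+ 2)^-1; pose gamma := x / y.
have h0 : 0 < h by rewrite invr_gt0 mulr_gt0 // exprn_gt0.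
have g0 : 0 < gamma by rewrite divr_gt0.
have g1 : gamma <= 1 by rewrite ler_pdivrMr // mul1r.
pose alg := two_level_alg E k0 h0 g0 g1 clique2.
have inf_le : (minimax_regret R E T <= worst_case_regret E T alg)%E.
  by apply: ereal_inf_lbound; exists alg.
apply: (le_trans inf_le).
apply: ge_ereal_sup => _ [L [a [L01 _ ->]]]; rewrite lee_fin.
apply: le_trans (two_level_regret k0 h0 g0 g1 clique2 edgeE a L01) _.
rewrite /drift_bound SE -/x y2 Ty.
have le : 4 * h * (S + #|'I_m|%:R) / gamma <= 4 * h * (3 * S) / gamma.
  rewrite ler_wpM2r ?invr_ge0 ?(ltW g0) // ler_wpM2l ?mulr_ge0 ?(ltW h0) //.
  by lra.
apply: (@le_trans _ _ ((gamma + 4 * h * (3 * S) / gamma) * y ^+ 3 + 3 * h^-1)).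
  by rewrite lerD2r ler_wpM2r ?exprn_ge0 ?(ltW y0) // lerD2l.
(* Exploration, second-order terms and initial potential contribute 1, 12 and 3 times [x * y ^+ 2],
   hence the constant 16. *)
rewrite Sx /h /gamma le_eqVlt; apply/orP; left; apply/eqP.
by field; rewrite !gt_eqF.
Qed.
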